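(* Let $p,q \in [1,\infty]$ with $p\leq q$, let $n \geq 2$ be an integer, and suppose $(p,q,n)\neq (1,\infty,2)$. Suppose that $\mathcal{L}_p^{n+1}$ and $\mathcal{L}_q^{n+1}$ are isomorphic, that is, $A\mathcal{L}_p^{n+1} = \mathcal{L}_q^{n+1}$ holds for some $A \in GL_{n+1}(\mathbb{R})$. Then $p=q$ must hold. Moreover, if $p\neq 2$, then $A \in \operatorname{Aut}(\mathcal{L}_1^{n+1})$.
   Context: For $p\in[1,\infty]$ the $p$-cone is $\mathcal{L}_p^{n+1} = \{(t,x)\in\mathbb{R}\times\mathbb{R}^n \mid t\geq \|x\|_p\}\subseteq\mathbb{R}^{n+1}$, where $\|x\|_p=(|x_1|^p+\cdots+|x_n|^p)^{1/p}$ for $p\in[1,\infty)$ and $\|x\|_\infty=\max(|x_1|,\ldots,|x_n|)$. For a convex cone $\mathcal{K}\subseteq\mathbb{R}^m$, $\operatorname{Aut}(\mathcal{K})=\{A\in GL_m(\mathbb{R})\mid A\mathcal{K}=\mathcal{K}\}$. *)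

(* Defs.v *)
From mathcomp Require Import all_boot all_order all_algebra.
From mathcomp Require Import all_classical all_reals all_analysis.

Set Implicit Arguments.
Unset Strict Implicit.
Unset Printing Implicit Defensive.

Import Order.TTheory GRing.Theory Num.Theory.

Local Open Scope classical_set_scope.
Local Open Scope ring_scope.

(* The exponent ranges over the extended reals and is meant to satisfy
   1 <= p; the value at -oo is junk. *)
Definition pnorm (R : realType) (n : nat) (p : \bar R) (x : 'cV[R]_n) : R :=
  match p with
  | EFin r => (\sum_(i < n) `|x i 0| `^ r) `^ r^-1
  | +oo%E => \big[Num.max/0]_(i < n) `|x i 0|
  | -oo%E => 0
  end.

(* R x R^n is encoded as 'cV_(1 + n), with (t, x) the block column
   col_mx t%:M x. *)
Definition pcone (R : realType) (n : nat) (p : \bar R) : set 'cV[R]_(1 + n) :=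
  [set col_mx tx.1%:M tx.2 | tx in [set tx : R * 'cV[R]_n | pnorm p tx.2 <= tx.1]].
Arguments pcone {R} n p.

Definition mximage (R : realType) (m : nat) (A : 'M[R]_m) (K : set 'cV[R]_m) :
  set 'cV[R]_m := [set A *m v | v in K].

Definition cone_aut (R : realType) (m : nat) (K : set 'cV[R]_m) : set 'M[R]_m :=
  [set A | A \in unitmx /\ mximage A K = K].

(* Main.v *)
Require Import Defs.
From mathcomp Require Import all_boot all_order all_algebra.
From mathcomp Require Import all_classical all_reals all_analysis.
From mathcomp Require Import ring lra zify.

Import Order.TTheory GRing.Theory Num.Theory.
Import numFieldNormedType.Exports.
Local Open Scope classical_set_scope.
Local Open Scope ring_scope.

(** Let [gap p (t, x) = ||x||_p - t], so that the p-cone is [gap p <= 0].  A linear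
    isomorphism of cones distorts the positive part of the gap by bounded factors only,
    hence it preserves the order of vanishing of [s |-> gap p (v + s w)] as [s -> 0+].
    Let [1 < p < oo].  At a vertex ray [(1, +-e_i)] the only possible order greater than
    1 is [p], it is attained, and the gap is never identically 0 unless [w] is parallel
    to [v].  At a boundary point with two nonzero coordinates the order 2 occurs.  For
    [p = 1] or [p = oo] every boundary point has a direction not parallel to it along
    which the gap vanishes identically.  Thus [p] and [q] are both in [(1, oo)] or both
    in [{1, oo}]; in the first case [p = q], and if moreover [p <> 2] the vertex rays are
    permuted up to scaling, which says that [A] is an automorphism of the 1-cone, as
    these rays generate it.  The 1-cone and the oo-cone have [2n] and [2^n] extreme rays.
    Finally, automorphisms of the oo-cone are the transposes of those of the 1-cone, and
    the latter are signed permutations up to scaling, so they preserve the oo-cone too. *)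

(** * Estimates for real powers *)

(* The quadratic term allows to compare [x ^ p] with its second-order expansion without
   a Taylor formula: see [powR_second_order]. *)
Lemma MVT_powR {R : realType} (p k a b : R) : 0 < a -> 0 < b ->
  exists2 c, Num.min a b <= c <= Num.max a b &
    (b `^ p - k * b ^+ 2) - (a `^ p - k * a ^+ 2) =
    (p * c `^ (p - 1) - 2 * k * c) * (b - a).
Proof.
move=> a0 b0.
pose f x : R := x `^ p - k * x ^+ 2.
pose df x : R := p * x `^ (p - 1) - 2 * k * x.
have dfE (x : R) : 0 < x -> is_derive x 1 f (df x).
  move=> x0; have d1 := @is_derive1_powR R p x x0.
  have d2 : is_derive x 1 (fun y : R => k * y ^+ 2) (2 * k * x).
    apply: is_derive_eq; rewrite /GRing.scale/=; ring.
  exact: is_deriveB.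
have cf (x : R) : 0 < x -> {for x, continuous f}.
  move=> /dfE d; apply: differentiable_continuous.
  exact/derivable1_diffP/ex_derive.
have key (x y : R) : 0 < x -> x <= y ->
    exists2 c, c \in `[x, y]%R & f y - f x = df c * (y - x).
  move=> x0 xy; apply: MVT_segment => //.
    by move=> z; rewrite in_itv/= => /andP[xz _]; apply/dfE/(lt_trans x0).
  apply: continuous_in_subspaceT => z; rewrite inE/= in_itv/= => /andP[xz _].
  exact/cf/(lt_le_trans x0).
have [ab|/ltW ba] := leP a b.
  have [c] := key _ _ a0 ab; rewrite in_itv/= => hc e.
  by exists c => //; exact: e.
have [c] := key _ _ b0 ba; rewrite in_itv/= => hc e.
by exists c => //; rewrite -/(f a) -/(f b) -opprB e -mulrN opprB.
Qed.

(** The derivative [p * c ^ (p - 1)] is nondecreasing in [c], so moving the intermediate point to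
    [a] can only lower its product with [b - a], on either side of [a]. *)
Lemma powR_tangent {R : realType} (p a b : R) : 1 <= p -> 0 < a -> 0 < b ->
  p * a `^ (p - 1) * (b - a) <= b `^ p - a `^ p.
Proof.
move=> p1 a0 b0; have [c] := MVT_powR p 0 a b a0 b0.
rewrite !mul0r !subr0 mulr0 mul0r subr0 => hc ->.
have p0 : 0 <= p by rewrite (le_trans _ p1).
have hp : 0 <= p - 1 by rewrite subr_ge0.
rewrite -!mulrA ler_wpM2l//; have [ab|/ltW ba] := leP a b.
  move: hc; rewrite (min_idPl _)// (max_idPr _)// => /andP[ac cb].
  rewrite ler_wpM2r ?subr_ge0// ge0_ler_powR// nnegrE ?(ltW a0)//.
  by rewrite (le_trans (ltW a0)).
move: hc; rewrite (min_idPr _)// (max_idPl _)// => /andP[bc ca].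
rewrite ler_wnM2r ?subr_le0// ge0_ler_powR// nnegrE ?(ltW a0)//.
by rewrite (le_trans (ltW b0)).
Qed.

(* Tangent-line bounds at both ends of [[X, Y]], with [Y ^ p = X ^ p + B]. *)
Lemma root_increment {R : realType} (p X B m M : R) : 1 < p ->
  0 < m -> m <= X -> 0 <= B -> X `^ p + B <= M `^ p -> 0 < M ->
  B / (p * M `^ (p - 1)) <= (X `^ p + B) `^ p^-1 - X <= B / (p * m `^ (p - 1)).
Proof.
move=> p1 m0 mX B0 BM M0.
have p0 : 0 < p by rewrite (lt_trans _ p1).
have X0 : 0 < X by rewrite (lt_le_trans m0).
have hp : 0 <= p - 1 by rewrite subr_ge0 ltW.
set Y := (X `^ p + B) `^ p^-1.
have YpE : Y `^ p = X `^ p + B.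
  by rewrite /Y -powRrM mulVf ?gt_eqF// powRr1// addr_ge0// powR_ge0.
have XY : X <= Y.
  rewrite -[X in X <= _](@powRr1 _ X) ?(ltW X0)// -(@mulfV _ p) ?gt_eqF// powRrM.
  by rewrite /Y ge0_ler_powR ?invr_ge0 ?nnegrE ?addr_ge0 ?powR_ge0 ?lerDl ?(ltW p0).
have Y0 : 0 < Y by rewrite (lt_le_trans X0).
have YM : Y <= M.
  rewrite -[X in _ <= X](@powRr1 _ M) ?(ltW M0)// -(@mulfV _ p) ?gt_eqF// powRrM.
  by rewrite /Y ge0_ler_powR ?invr_ge0 ?nnegrE ?addr_ge0 ?powR_ge0 ?(ltW p0).
have BE : B = Y `^ p - X `^ p by rewrite YpE addrAC subrr add0r.
apply/andP; split.
  rewrite ler_pdivrMr ?mulr_gt0 ?powR_gt0//.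
  have := powR_tangent p Y X (ltW p1) Y0 X0; rewrite -subr_le0 opprB.
  move=> h; apply: (@le_trans _ _ (p * Y `^ (p - 1) * (Y - X))).
    rewrite [leLHS]BE -subr_le0; apply: le_trans h; rewrite le_eqVlt; apply/orP; left.
    by apply/eqP; ring.
  rewrite mulrC ler_wpM2l ?subr_ge0// ler_wpM2l ?(ltW p0)//.
  by rewrite ge0_ler_powR ?nnegrE ?(ltW Y0) ?(ltW M0).
rewrite ler_pdivlMr ?mulr_gt0 ?powR_gt0//.
apply: (@le_trans _ _ (p * X `^ (p - 1) * (Y - X))); last first.
  by rewrite BE powR_tangent// ltW.
rewrite mulrC ler_wpM2r ?subr_ge0// ler_wpM2l ?(ltW p0)//.
by rewrite ge0_ler_powR ?nnegrE ?(ltW m0) ?(ltW X0).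
Qed.

(** For any [k], two uses of the mean value theorem write the remainder minus [k * u ^ 2] as
    [p * (p - 1) * y ^ (p - 2) - 2 * k] times a nonnegative factor, with [y] between 1/2 and 2. The
    two constants fix the sign of the first factor. *)
Lemma powR_second_order {R : realType} (p : R) : 1 < p ->
  exists k K : R, [/\ 0 < k, 0 < K & forall u, `|u| <= 2^-1 ->
    k * u ^+ 2 <= (1 + u) `^ p - 1 - p * u <= K * u ^+ 2].
Proof.
move=> p1.
have p0 : 0 < p by rewrite (lt_trans _ p1).
have hp : 0 < p - 1 by rewrite subr_gt0.
have h0 : 0 < 2^-1 :> R by rewrite invr_gt0.
have h2 : 2^-1 <= 2 :> R by lra.
(* [e = p - 2] may have either sign, so [y ^ e] may increase or decrease; hence the minimum and
   maximum of its end values. *)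
pose e := p - 1 - 1.
pose lo := Num.min (2^-1 `^ e) (2 `^ e).
pose hi := Num.max (2^-1 `^ e) (2 `^ e).
have bnd y : 2^-1 <= y <= 2 -> lo <= y `^ e <= hi.
  move=> /andP[y1 y2]; have y0 : 0 < y by lra.
  have y0' := ltW y0; have h0' := ltW h0.
  rewrite /lo /hi; case: (leP 0 e) => he.
    have a1 : 2^-1 `^ e <= y `^ e by rewrite ge0_ler_powR ?nnegrE.
    have a2 : y `^ e <= 2 `^ e by rewrite ge0_ler_powR ?nnegrE.
    by rewrite ge_min le_max a1 a2 orbT.
  have he' : 0 <= - e by lra.
  have inv (z : R) : z `^ e = (z `^ (- e))^-1 by rewrite powRN invrK.
  have a1 : y `^ e <= 2^-1 `^ e.
    by rewrite !inv lef_pV2 ?posrE ?powR_gt0// (ge0_ler_powR he') ?nnegrE.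
  have a2 : 2 `^ e <= y `^ e.
    by rewrite !inv lef_pV2 ?posrE ?powR_gt0// (ge0_ler_powR he') ?nnegrE.
  by rewrite ge_min le_max a1 a2 orbT.
have lo0 : 0 < lo by rewrite /lo lt_min !powR_gt0.
have hi0 : 0 < hi by rewrite /hi lt_max !powR_gt0.
have key (u k : R) : `|u| <= 2^-1 -> exists c y, [/\ 0 <= c * u, 2^-1 <= y <= 2 &
    (1 + u) `^ p - 1 - p * u - k * u ^+ 2 =
      (p * (p - 1) * y `^ e - 2 * k) * (c * u)].
  rewrite ler_norml => /andP[u1 u2].
  have u0 : 0 < 1 + u by lra.
  have [c hc Ec] := MVT_powR p k 1 (1 + u) ltr01 u0.
  have {hc} [c1 c2 c3] : [/\ 2^-1 <= c, c <= 2 & 0 <= (c - 1) * u].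
    move: hc; case: (leP 1 (1 + u)) => hu /andP[ca cb].
      split; [lra|lra|apply: mulr_ge0; lra].
    split; [lra|lra|rewrite -mulrNN; apply: mulr_ge0; lra].
  have c0 : 0 < c by lra.
  have [y hy Ey] := MVT_powR (p - 1) 0 1 c ltr01 c0.
  exists (c - 1), y; split=> //.
    by move: hy; case: (leP 1 c) => hu /andP[ca cb]; apply/andP; split; lra.
  move: Ec Ey; rewrite !powR1 -/e !mul0r !subr0 mulr0 mul0r subr0 => Ec Ey.
  have Ec' : (1 + u) `^ p = 1 - k + k * (1 + u) ^+ 2 + (p * c `^ (p - 1) - 2 * k * c) * u.
    move: Ec; rewrite expr1n; have -> : 1 + u - 1 = u by ring.
    by move=> <-; ring.
  have Ey' : c `^ (p - 1) = 1 + (p - 1) * y `^ e * (c - 1).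
    by rewrite -Ey; ring.
  by rewrite Ec' Ey'; ring.
exists (p * (p - 1) * lo / 2), (p * (p - 1) * hi / 2); split.
- by rewrite divr_gt0// !mulr_gt0.
- by rewrite divr_gt0// !mulr_gt0.
- move=> u hu; apply/andP; split; rewrite -subr_ge0.
    have [c [y [cu /bnd/andP[y1 y2] ->]]] := key u (p * (p - 1) * lo / 2) hu.
    apply: mulr_ge0 => //; have -> : 2 * (p * (p - 1) * lo / 2) = p * (p - 1) * lo by field.
    by rewrite subr_ge0 ler_wpM2l// mulr_ge0// ltW.
  rewrite -oppr_le0 opprB.
  have [c [y [cu /bnd/andP[y1 y2] ->]]] := key u (p * (p - 1) * hi / 2) hu.
  apply: mulr_le0_ge0 => //; have -> : 2 * (p * (p - 1) * hi / 2) = p * (p - 1) * hi by field.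
  by rewrite subr_le0 ler_wpM2l// mulr_ge0// ltW.
Qed.

(** Replaces a limit as [s -> 0+]; it serves to show that linear terms of the gap vanish. *)
Lemma le0_of_le_powR {R : realType} (a C d k : R) : 0 < k -> 0 < d ->
  (forall s, 0 < s < d -> a <= C * s `^ k) -> a <= 0.
Proof.
move=> k0 d0 H; rewrite leNgt; apply/negP => a0.
have C0 : 0 < C.
  have := H (d / 2); rewrite divr_gt0//= ltr_pdivrMr// ltr_pMr// ltr1n => /(_ isT) h.
  by have := lt_le_trans a0 h; rewrite pmulr_lgt0// powR_gt0// divr_gt0.
(* Small enough that [C * s ^ k <= a / 2]. *)
pose s := Num.min (d / 2) ((a / (2 * C)) `^ k^-1).
have aC : 0 < a / (2 * C) by rewrite divr_gt0// mulr_gt0.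
have s0 : 0 < s by rewrite /s lt_min divr_gt0//= powR_gt0.
have sd : s < d by rewrite /s gt_min ltr_pdivrMr// ltr_pMr// ltr1n.
have := H s; rewrite s0 sd => /(_ isT).
have : s `^ k <= a / (2 * C).
  rewrite -[leRHS]powRr1 ?(ltW aC)// -[X in _ <= _ `^ X](@mulVf _ k) ?gt_eqF// powRrM.
  rewrite ge0_ler_powR ?nnegrE ?(ltW k0) ?(ltW s0)// ?powR_ge0//.
  by rewrite /s ge_min lexx orbT.
move=> /(ler_wpM2l (ltW C0)) h1 h2.
have := le_trans h2 h1; have -> : C * (a / (2 * C)) = a / 2 by field; rewrite gt_eqF.
lra.
Qed.

(** Otherwise division by [s ^ p] bounds [c] by [C * s ^ (q - p)], which tends to 0. *)
Lemma exponent_le {R : realType} (c C d p q : R) : 0 < c -> 0 < d ->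
  (forall s, 0 < s < d -> c * s `^ p <= C * s `^ q) -> q <= p.
Proof.
move=> c0 d0 H; rewrite leNgt; apply/negP => pq.
have : c <= 0; last by rewrite leNgt c0.
apply: (@le0_of_le_powR R c C d (q - p)) => //; first by rewrite subr_gt0.
move=> s /[dup] /andP[s0 _] /H; rewrite -{1}(subrK p q) (@powRD _ s (q - p) p); last first.
  by apply/implyP => _; rewrite gt_eqF.
by rewrite mulrA (ler_pM2r (powR_gt0 p s0)).
Qed.

(** * The p-norms *)

Lemma pnorm_ge0 {R : realType} {n : nat} (p : \bar R) (x : 'cV[R]_n) :
  0 <= pnorm p x.
Proof.
by case: p => [r||] /=; rewrite ?powR_ge0//; apply: bigmax_ge_id.
Qed.

Lemma pnorm_fin {R : realType} {n : nat} (p : R) (x : 'cV[R]_n) : 0 < p ->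
  pnorm p%:E x `^ p = \sum_(i < n) `|x i 0| `^ p.
Proof.
move=> p0; rewrite /= -powRrM mulVf ?gt_eqF// powRr1//.
by apply: sumr_ge0 => i _; exact: powR_ge0.
Qed.

Lemma pnormZ {R : realType} {n : nat} (p : \bar R) (a : R) (x : 'cV[R]_n) :
  (1%:E <= p)%E -> 0 <= a -> pnorm p (a *: x) = a * pnorm p x.
Proof.
case: p => [p| |] //= hp a0; last first.
  under eq_bigr do rewrite mxE normrM (ger0_norm a0).
  apply/eqP; rewrite eq_le; apply/andP; split.
    apply: bigmax_le; first by rewrite mulr_ge0// bigmax_ge_id.
    by move=> i _; rewrite ler_wpM2l// (le_bigmax 0 (fun i => `|x i 0|)).
  have [->|an0] := eqVneq a 0; first by rewrite mul0r bigmax_ge_id.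
  have ap : 0 < a by rewrite lt_def an0.
  rewrite -ler_pdivlMl//; apply: bigmax_le.
    by rewrite mulr_ge0 ?invr_ge0 ?bigmax_ge_id.
  move=> i _; rewrite ler_pdivlMl//.
  exact: (le_bigmax 0 (fun i => a * `|x i 0|)).
have {}hp : 0 < p by move: hp; rewrite lee_fin; apply: lt_le_trans.
under eq_bigr do rewrite mxE normrM (ger0_norm a0) powRM//.
rewrite -mulr_sumr powRM ?powR_ge0//; last by apply: sumr_ge0 => i _; exact: powR_ge0.
by rewrite -powRrM mulfV ?gt_eqF// powRr1.
Qed.

Lemma pnorm_eq0 {R : realType} {n : nat} (p : \bar R) (x : 'cV[R]_n) :
  (1%:E <= p)%E -> pnorm p x = 0 -> x = 0.
Proof.
case: p => [p| |] //= hp => [/powR_eq0_eq0/eqP|h]; last first.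
  apply/matrixP => i j; rewrite ord1 mxE; apply/eqP; rewrite -normr_le0 -[leRHS]h.
  exact: (le_bigmax 0 (fun i => `|x i 0|)).
rewrite psumr_eq0; last by move=> i _; exact: powR_ge0.
move=> /allP h; apply/matrixP => i j; rewrite ord1 mxE.
by have /eqP/powR_eq0_eq0/eqP := h i (mem_index_enum i); rewrite normr_eq0 => /eqP.
Qed.

Lemma powR_convex {R : realType} (p t x y : R) : 1 <= p -> 0 <= t <= 1 ->
  0 <= x -> 0 <= y ->
  (t * x + (1 - t) * y) `^ p <= t * x `^ p + (1 - t) * y `^ p.
Proof.
move=> p1 /andP[t0 t1] x0 y0.
have h : Itv.spec (@Itv.num_sem R) (Itv.Real `[0, 1]%Z) t.
  by rewrite /Itv.spec/= /Itv.num_sem/= in_itv/= t0 t1 realE t0.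
have := @convex_powR R p p1 (Itv.mk h) x y.
rewrite !inE/= !in_itv/= !andbT => /(_ x0 y0).
by rewrite !convRE/=.
Qed.

(** Minkowski's inequality. For finite [p] and nonzero norms [a], [b], the vector
    [(x + y) / (a + b)] is the convex combination of [x / a] and [y / b] with weight [a / (a + b)],
    and [powR_convex] is summed over the coordinates. *)
Lemma pnormD {R : realType} {n : nat} (p : \bar R) (x y : 'cV[R]_n) :
  (1%:E <= p)%E -> pnorm p (x + y) <= pnorm p x + pnorm p y.
Proof.
move=> hp.
have [/(pnorm_eq0 p x hp)->|x0] := eqVneq (pnorm p x) 0.
  by rewrite add0r lerDr pnorm_ge0.
have [/(pnorm_eq0 p y hp)->|y0] := eqVneq (pnorm p y) 0.
  by rewrite addr0 lerDl pnorm_ge0.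
have {}x0 : 0 < pnorm p x by rewrite lt_def x0 pnorm_ge0.
have {}y0 : 0 < pnorm p y by rewrite lt_def y0 pnorm_ge0.
case: p hp x0 y0 => [p| |] // hp; last first.
  move=> _ _ /=; apply: bigmax_le; first by rewrite addr_ge0// bigmax_ge_id.
  move=> i _; rewrite mxE (le_trans (ler_normD _ _))// lerD//.
    exact: (le_bigmax 0 (fun i => `|x i 0|)).
  exact: (le_bigmax 0 (fun i => `|y i 0|)).
rewrite lee_fin in hp; have p0 : 0 < p by apply: lt_le_trans hp.
move Ea : (pnorm p%:E x) => a; move Eb : (pnorm p%:E y) => b a0 b0.
have s0 : 0 < a + b := addr_gt0 a0 b0.
have sum1 (z : 'cV[R]_n) (c : R) : 0 < c -> pnorm p%:E z = c ->
    \sum_(i < n) (`|z i 0| / c) `^ p = 1.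
  move=> c0 zc; under eq_bigr do rewrite powRM ?invr_ge0 ?(ltW c0)//.
  rewrite -mulr_suml -(pnorm_fin p z p0) zc -powRM ?invr_ge0 ?(ltW c0)//.
  by rewrite mulfV ?gt_eqF// powR1.
rewrite -[leRHS]powRr1 ?(ltW s0)// -[X in _ <= _ `^ X](@mulfV _ p) ?gt_eqF// powRrM.
rewrite [leLHS]/=; apply: ge0_ler_powR.
- by rewrite invr_ge0 ltW.
- by rewrite nnegrE; apply: sumr_ge0 => i _; exact: powR_ge0.
- by rewrite nnegrE powR_ge0.
(* The parenthesis equals 1, since both sums belong to normalized vectors. *)
have -> : (a + b) `^ p = (a + b) `^ p *
    (a / (a + b) * \sum_(i < n) (`|x i 0| / a) `^ p +
     (1 - a / (a + b)) * \sum_(i < n) (`|y i 0| / b) `^ p).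
  by rewrite !sum1// !mulr1 subrKC mulr1.
rewrite !mulr_sumr -big_split mulr_sumr; apply: ler_sum => i _.
have t1 : 0 <= a / (a + b) <= 1.
  by rewrite divr_ge0 ?(ltW a0) ?(ltW s0)//= ler_pdivrMr// mul1r lerDl ltW.
have xa : 0 <= `|x i 0| / a by rewrite divr_ge0// ltW.
have yb : 0 <= `|y i 0| / b by rewrite divr_ge0// ltW.
have /(ler_wpM2l (powR_ge0 (a + b) p)) := powR_convex p _ _ _ hp t1 xa yb.
rewrite -powRM ?(ltW s0)//; last first.
  move: t1 => /andP[t0 t1].
  by rewrite addr_ge0// mulr_ge0// subr_ge0.
apply: le_trans; rewrite mxE.
have -> : (a + b) * (a / (a + b) * (`|x i 0| / a) + (1 - a / (a + b)) * (`|y i 0| / b)) =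
    `|x i 0| + `|y i 0|.
  by field; rewrite !gt_eqF.
by rewrite ge0_ler_powR ?nnegrE ?addr_ge0 ?(ltW p0)// ler_normD.
Qed.

(** * Points of the ambient space and the gap *)

Definition pt {R : realType} {n : nat} (t : R) (x : 'cV[R]_n) : 'cV[R]_(1 + n) :=
  col_mx t%:M x.

Lemma pt_eta {R : realType} {n : nat} (z : 'cV[R]_(1 + n)) :
  z = pt (usubmx z 0 0) (dsubmx z).
Proof. by rewrite /pt -mx11_scalar vsubmxK. Qed.

Lemma ptD {R : realType} {n : nat} (t u : R) (x y : 'cV[R]_n) :
  pt t x + pt u y = pt (t + u) (x + y).
Proof. by rewrite /pt add_col_mx raddfD. Qed.

Lemma ptZ {R : realType} {n : nat} (a t : R) (x : 'cV[R]_n) :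
  a *: pt t x = pt (a * t) (a *: x).
Proof. by rewrite /pt scale_col_mx scale_scalar_mx. Qed.

Lemma pt_inj {R : realType} {n : nat} (t u : R) (x y : 'cV[R]_n) :
  pt t x = pt u y -> t = u /\ x = y.
Proof.
move=> /eq_col_mx[/matrixP/(_ 0 0)]; rewrite !mxE eqxx.
by rewrite /= !mulr1n => -> ->.
Qed.

Lemma pt0 {R : realType} {n : nat} : pt 0 0 = 0 :> 'cV[R]_(1 + n).
Proof. by rewrite /pt raddf0 col_mx0. Qed.

Lemma pt_sum {R : realType} {n m : nat} (f : 'I_m -> R) (g : 'I_m -> 'cV[R]_n) :
  \sum_i pt (f i) (g i) = pt (\sum_i f i) (\sum_i g i).
Proof.
by rewrite /pt; elim/big_rec3: _ => [|i x y z _ ->]; rewrite -/(pt _ _) ?pt0// ptD.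
Qed.

Lemma col_sum_delta {R : realType} {n : nat} (x : 'cV[R]_n) :
  \sum_i x i 0 *: delta_mx i 0 = x.
Proof. by rewrite [RHS]matrix_sum_delta; apply: eq_bigr => i _; rewrite big_ord1. Qed.

(* [gap p z] is the least [t] such that [z + t *: pt 1 0] lies in the p-cone. *)
Definition gap {R : realType} {n : nat} (p : \bar R) (z : 'cV[R]_(1 + n)) : R :=
  pnorm p (dsubmx z) - usubmx z 0 0.

Lemma gap_pt {R : realType} {n : nat} (p : \bar R) (t : R) (x : 'cV[R]_n) :
  gap p (pt t x) = pnorm p x - t.
Proof. by rewrite /gap /pt col_mxKu col_mxKd mxE eqxx mulr1n. Qed.

Lemma pconeE {R : realType} {n : nat} (p : \bar R) :
  pcone n p = [set z | gap p z <= 0].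
Proof.
apply/seteqP; split => [_ [[t x] /= h <-]|z h].
  by rewrite -/(pt t x) gap_pt subr_le0.
exists (usubmx z 0 0, dsubmx z); last by rewrite -/(pt _ _) -pt_eta.
by rewrite /= -subr_le0.
Qed.

(** * The gap under isomorphisms of cones *)

Section Gap.
Context {R : realType} {n : nat}.
Implicit Types (p q : \bar R) (z w : 'cV[R]_(1 + n)) (A B : 'M[R]_(1 + n)).

Lemma gapZ p a z : (1%:E <= p)%E -> 0 <= a -> gap p (a *: z) = a * gap p z.
Proof. by move=> hp a0; rewrite (pt_eta z) ptZ !gap_pt pnormZ// mulrBr. Qed.

Lemma gapD p z w : (1%:E <= p)%E -> gap p (z + w) <= gap p z + gap p w.
Proof.
move=> hp; rewrite (pt_eta z) (pt_eta w) ptD !gap_pt.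
by have := pnormD p (dsubmx z) (dsubmx w) hp; lra.
Qed.

Lemma gap0 p : (1%:E <= p)%E -> gap p (0 : 'cV[R]_(1 + n)) = 0.
Proof. by move=> hp; rewrite -(scale0r 0) gapZ// mul0r. Qed.

Lemma gap_shift p z t : gap p (z + t *: pt 1 0) = gap p z - t.
Proof.
by rewrite (pt_eta z) ptZ ptD !gap_pt scaler0 addr0 mulr1 opprD addrA.
Qed.

Lemma gap_apex p : (1%:E <= p)%E -> gap p (pt 1 (0 : 'cV[R]_n)) = - 1.
Proof. by move=> hp; rewrite -[pt 1 0]add0r -[pt 1 0]scale1r gap_shift gap0// sub0r. Qed.

(** Carrying the inverse and both inclusions makes the notion symmetric, so each estimate for [A]
    also yields one for [B]. *)
Definition cone_iso p q A B : Prop :=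
  [/\ A *m B = 1%:M, B *m A = 1%:M,
      forall z, gap p z <= 0 -> gap q (A *m z) <= 0 &
      forall z, gap q z <= 0 -> gap p (B *m z) <= 0].

Lemma cone_iso_sym p q A B : cone_iso p q A B -> cone_iso q p B A.
Proof. by case. Qed.

Lemma mximage_cone_iso p q A : A \in unitmx ->
  mximage A (pcone n p) = pcone n q -> cone_iso p q A (invmx A).
Proof.
move=> uA; rewrite !pconeE => h; split.
- exact: mulmxV.
- exact: mulVmx.
- by move=> z hz; have : mximage A [set z | gap p z <= 0] (A *m z) by [exists z]; rewrite h.
- move=> z hz; have : [set z | gap q z <= 0] z by [].
  by rewrite -h => -[u hu <-]; rewrite mulKmx.
Qed.

Lemma cone_iso_mximage p q A B :
  cone_iso p q A B -> A \in unitmx /\ mximage A (pcone n p) = pcone n q.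
Proof.
move=> [AB BA hA hB]; split; first by case: (mulmx1_unit AB).
rewrite !pconeE; apply/seteqP; split => [_ [z hz <-]|z hz]; first exact: hA.
by exists (B *m z); [exact: hB|rewrite mulmxA AB mul1mx].
Qed.

(** Adding [gap p z] times [pt 1 0] brings [z] into the p-cone, and the image of the sum lies in the
    q-cone; subadditivity charges the correction to the gap of [A *m (- pt 1 0)]. *)
Lemma gap_ub p q A B : (1%:E <= p)%E -> (1%:E <= q)%E -> cone_iso p q A B ->
  exists2 M, 0 < M & forall z, 0 <= gap p z -> gap q (A *m z) <= M * gap p z.
Proof.
move=> hp hq [_ _ hA _]; pose c := gap q (A *m (- pt 1 0)).
exists (`|c| + 1) => [|z hz]; first by rewrite ltr_wpDl.
have /hA h : gap p (z + gap p z *: pt 1 0) <= 0 by rewrite gap_shift subrr.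
have -> : A *m z = A *m (z + gap p z *: pt 1 0) + gap p z *: (A *m (- pt 1 0)).
  by rewrite scalemxAr -mulmxDr scalerN addrK.
apply: le_trans (gapD _ _ _ hq) _; rewrite gapZ// -/c [leRHS]mulrC.
rewrite -[leRHS]add0r lerD// ler_wpM2l//.
by rewrite (le_trans (ler_norm c))// lerDl.
Qed.

(** For [b = B *m pt 1 0] and large [m], the point [- b + m *: pt 1 0] lies in the p-cone, so [m]
    times the image of [pt 1 0] is a point of the q-cone plus the interior point [pt 1 0]. *)
Lemma gap_apex_lt0 p q A B : (1%:E <= p)%E -> (1%:E <= q)%E -> cone_iso p q A B ->
  gap q (A *m pt 1 0) < 0.
Proof.
move=> hp hq h; pose b := B *m pt 1 0.
pose m := `|gap p (- b)| + 1.
have m0 : 0 < m by rewrite ltr_wpDl.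
case: h => AB _ hA _.
have /hA h : gap p (- b + m *: pt 1 0) <= 0.
  by rewrite gap_shift subr_le0 (le_trans (ler_norm _))// lerDl.
have e : m *: (A *m pt 1 0) = A *m (- b + m *: pt 1 0) + pt 1 0.
  by rewrite mulmxDr mulmxN /b mulmxA AB mul1mx -scalemxAr addrAC addNr add0r.
rewrite -(pmulr_rlt0 _ m0) -gapZ ?(ltW m0)// e.
apply: le_lt_trans (gapD _ _ _ hq) _; rewrite gap_apex//; lra.
Qed.

(** [z] is a boundary point plus a positive multiple of [pt 1 0], whose image has negative gap. *)
Lemma gap_lt0 p q A B z : (1%:E <= p)%E -> (1%:E <= q)%E -> cone_iso p q A B ->
  gap p z < 0 -> gap q (A *m z) < 0.
Proof.
move=> hp hq h gz; have a0 := gap_apex_lt0 _ _ _ _ hp hq h.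
case: h => _ _ hA _.
have /hA h : gap p (z + gap p z *: pt 1 0) <= 0 by rewrite gap_shift subrr.
have -> : A *m z = A *m (z + gap p z *: pt 1 0) + (- gap p z) *: (A *m pt 1 0).
  by rewrite mulmxDr -scalemxAr scaleNr addrK.
apply: le_lt_trans (gapD _ _ _ hq) _; rewrite gapZ ?oppr_ge0 ?(ltW gz)//.
have : - gap p z * gap q (A *m pt 1 0) < 0 by rewrite nmulr_llt0// oppr_gt0.
lra.
Qed.

Lemma gap_eq0 p q A B z : (1%:E <= p)%E -> (1%:E <= q)%E -> cone_iso p q A B ->
  gap p z = 0 -> gap q (A *m z) = 0.
Proof.
move=> hp hq h gz; apply/eqP; rewrite eq_le; apply/andP; split.
  by case: h => _ _ hA _; apply: hA; rewrite gz.
rewrite leNgt; apply/negP => /(gap_lt0 _ _ _ _ _ hq hp (cone_iso_sym _ _ _ _ h)).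
by case: h => _ BA _ _; rewrite mulmxA BA mul1mx gz ltxx.
Qed.

(* Only [s > 0] is tested: if [r > 1] and the cone is smooth at [z], this already forces
   [w] to be tangent. *)
Definition contact p (r : R) z w : Prop := exists c C d : R, [/\ 0 < c, 0 < d &
  forall s, 0 < s < d -> c * s `^ r <= gap p (z + s *: w) <= C * s `^ r].

(** A boundary segment leaves [z] in direction [w]. Multiples of a boundary point [z] are always
    flat at [z], so only other directions carry information. *)
Definition flat p z w : Prop := exists2 d : R, 0 < d &
  forall s, 0 < s < d -> gap p (z + s *: w) = 0.

(** The upper bound comes from [gap_ub] for [A], the lower one from [gap_ub] for [B]. *)
Lemma contact_iso p q A B r z w : (1%:E <= p)%E -> (1%:E <= q)%E ->
  cone_iso p q A B -> contact p r z w -> contact q r (A *m z) (A *m w).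
Proof.
move=> hp hq h [c [C [d [c0 d0 H]]]].
have [M M0 hM] := gap_ub _ _ _ _ hp hq h.
have [M' M'0 hM'] := gap_ub _ _ _ _ hq hp (cone_iso_sym _ _ _ _ h).
exists (c / M'), (M * C), d; split=> //; first exact: divr_gt0.
move=> s hs; have /andP[g1 g2] := H s hs.
have g0 : 0 < gap p (z + s *: w).
  by apply: lt_le_trans g1; rewrite mulr_gt0// powR_gt0//; case/andP: hs.
rewrite scalemxAr -mulmxDr.
have := hM _ (ltW g0).
have : 0 <= gap q (A *m (z + s *: w)).
  rewrite leNgt; apply/negP => /(gap_lt0 _ _ _ _ _ hq hp (cone_iso_sym _ _ _ _ h)).
  by case: h => _ BA _ _; rewrite mulmxA BA mul1mx ltNge (ltW g0).
move=> /hM'; case: h => _ BA _ _; rewrite mulmxA BA mul1mx => h1 h2.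
apply/andP; split; first by rewrite mulrAC ler_pdivrMr// [leRHS]mulrC (le_trans _ h1).
by rewrite (le_trans h2)// -mulrA ler_wpM2l// ltW.
Qed.

Lemma flat_iso p q A B z w : (1%:E <= p)%E -> (1%:E <= q)%E ->
  cone_iso p q A B -> flat p z w -> flat q (A *m z) (A *m w).
Proof.
move=> hp hq h [d d0 H]; exists d => // s /H g.
by rewrite scalemxAr -mulmxDr (gap_eq0 _ _ _ _ _ hp hq h).
Qed.

End Gap.

(** * Vertices, two-coordinate boundary points and flat directions *)

(** The boolean follows [numEsign]: [(i, x i 0 < 0)] is the vertex on the side of [x i 0]. *)
Definition ray {R : realType} {n : nat} (ib : 'I_n * bool) : 'cV[R]_(1 + n) :=
  pt 1 ((-1) ^+ ib.2 *: delta_mx ib.1 0).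

Lemma scale_ray {R : realType} {n : nat} (a : R) (i : 'I_n) (b : bool) :
  a *: ray (i, b) = pt a (((-1) ^+ b * a) *: delta_mx i 0).
Proof. by rewrite /ray ptZ mulr1 scalerA mulrC. Qed.

Lemma ray_neq0 {R : realType} {n : nat} (ib : 'I_n * bool) : ray ib != 0 :> 'cV[R]_(1 + n).
Proof.
by apply/eqP; rewrite -pt0 => /pt_inj[/eqP]; rewrite oner_eq0.
Qed.

Lemma pnorm_delta {R : realType} {n : nat} (p a : R) (i : 'I_n) : 0 < p ->
  pnorm p%:E (a *: delta_mx i 0) = `|a|.
Proof.
move=> p0; rewrite /= (bigD1 i)//= big1 => [|j ji]; last first.
  by rewrite !mxE (negbTE ji) mulr0 normr0 powR0 ?gt_eqF.
by rewrite !mxE !eqxx mulr1 addr0 -powRrM mulfV ?gt_eqF// powRr1.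
Qed.

Lemma eq_scale_delta {R : realType} {n : nat} (i : 'I_n) (x : 'cV[R]_n) :
  (forall j, j != i -> x j 0 = 0) -> x = x i 0 *: delta_mx i 0.
Proof.
move=> h; apply/matrixP => j k; rewrite ord1 !mxE eqxx andbT.
by have [->|/h ->] := eqVneq j i; rewrite ?mulr1 ?mulr0.
Qed.

Lemma gap0_ray_or_two {R : realType} {n : nat} (p : R) (v : 'cV[R]_(1 + n)) :
  1 < p -> v != 0 -> gap p%:E v = 0 ->
  (exists2 a, 0 < a & exists ib, v = a *: ray ib) \/
  exists x i j, [/\ v = pt (pnorm p%:E x) x, i != j, x i 0 != 0 & x j 0 != 0].
Proof.
move=> p1; rewrite {1 2}(pt_eta v) gap_pt; set t := usubmx v 0 0; set x := dsubmx v => v0.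
have p0 : 0 < p by apply: lt_trans p1.
move/eqP; rewrite subr_eq0 => /eqP tE; rewrite -tE in v0.
have [i xi] : exists i, x i 0 != 0.
  apply/existsP; apply: contraNT v0 => /existsPn x0.
  have -> : x = 0 by apply/matrixP => k l; rewrite ord1 [RHS]mxE; have := x0 k; rewrite negbK => /eqP.
  have -> : pnorm p%:E (0 : 'cV[R]_n) = 0.
    by rewrite -(scale0r (0 : 'cV[R]_n)) pnormZ ?lee_fin ?mul0r// ltW.
  by rewrite pt0.
have [/existsP[j /andP[ji xj]]|/existsPn h] := boolP [exists j, (j != i) && (x j 0 != 0)].
  by right; exists x, j, i; rewrite tE -pt_eta.
left; have xE : x = x i 0 *: delta_mx i 0.
  apply: eq_scale_delta => j ji; have := h j.
  by rewrite ji negbK => /eqP.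
exists `|x i 0|; first by rewrite normr_gt0.
exists (i, x i 0 < 0); rewrite scale_ray -numEsign -xE (pt_eta v) -/t -/x -tE.
by rewrite [in LHS]xE pnorm_delta// -xE.
Qed.

(* [D] is the derivative of the gap along the direction, [S] collects the coordinates
   that vanish at the vertex. *)
Lemma vertex_gap {R : realType} {n : nat} (p a t : R) (i : 'I_n) (b : bool) (y : 'cV[R]_n) :
  1 < p -> 0 < a -> exists k K d : R, [/\ 0 < k, 0 < K, 0 < d &
    forall s, 0 < s < d ->
      let D := (-1) ^+ b * y i 0 - t in
      let S := \sum_(j < n | j != i) `|y j 0| `^ p in
      s * D + k * S * s `^ p <= gap p%:E (a *: ray (i, b) + s *: pt t y)
        <= s * D + K * S * s `^ p].
Proof.
move=> p1 a0; have p0 : 0 < p by apply: lt_trans p1.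
pose S := \sum_(j < n | j != i) `|y j 0| `^ p.
have S0 : 0 <= S by apply: sumr_ge0 => j _; exact: powR_ge0.
have W0 : 0 < (2 * a) `^ p + S by rewrite ltr_wpDr// powR_gt0// mulr_gt0.
(* Upper bound for the norm along the segment, where [X <= 2 * a] and [s <= 1]. *)
pose M := ((2 * a) `^ p + S) `^ p^-1.
have M0 : 0 < M by rewrite powR_gt0.
have MpE : M `^ p = (2 * a) `^ p + S by rewrite /M -powRrM mulVf ?gt_eqF// powRr1// ltW.
have m0 : 0 < a / 2 by rewrite divr_gt0.
(* For [s < d] the coordinate [i] moves by at most [a / 2], so it keeps its sign. *)
pose d := Num.min 1 (a / (2 * (`|y i 0| + 1))).
have d0 : 0 < d by rewrite /d lt_min ltr01 divr_gt0// mulr_gt0// ltr_wpDl.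
exists (p * M `^ (p - 1))^-1, (p * (a / 2) `^ (p - 1))^-1, d; split=> //.
- by rewrite invr_gt0 mulr_gt0// powR_gt0.
- by rewrite invr_gt0 mulr_gt0// powR_gt0.
move=> s /andP[s0]; rewrite /d lt_min => /andP[s1].
rewrite ltr_pdivlMr ?mulr_gt0 ?ltr_wpDl// => sa /=; rewrite -/S.
have sy : s * `|y i 0| <= a / 2 by lra.
have {sy} [sy1 sy2] : - (a / 2) <= s * ((-1) ^+ b * y i 0) /\ s * ((-1) ^+ b * y i 0) <= a / 2.
  apply/andP; rewrite -ler_norml !normrM normr_sign mul1r (ger0_norm (ltW s0)) //.
pose X := a + s * ((-1) ^+ b * y i 0).
have X0 : a / 2 <= X by rewrite /X; lra.
have XM : X <= 2 * a by rewrite /X; lra.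
have XE : `|((-1) ^+ b * a) + s * y i 0| = X.
  have -> : (-1) ^+ b * a + s * y i 0 = (-1) ^+ b * X.
    by rewrite /X; case: (b); rewrite ?expr0 ?expr1; ring.
  by rewrite normrM normr_sign mul1r ger0_norm// (le_trans _ X0)// ltW.
have sp : s `^ p <= 1.
  have -> : 1 = 1 `^ p by rewrite powR1.
  by rewrite ge0_ler_powR ?nnegrE ?(ltW p0) ?(ltW s0) ?(ltW s1).
have B0 : 0 <= S * s `^ p by rewrite mulr_ge0// powR_ge0.
have BM : X `^ p + S * s `^ p <= M `^ p.
  rewrite MpE lerD// ?ler_piMr// ge0_ler_powR ?nnegrE ?(ltW p0)//.
    by rewrite (le_trans _ X0)// ltW.
  by rewrite mulr_ge0// ltW.
have := root_increment p X (S * s `^ p) (a / 2) M p1 m0 X0 B0 BM M0.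
rewrite scale_ray ptZ ptD gap_pt.
have -> : pnorm p%:E (((-1) ^+ b * a) *: delta_mx i 0 + s *: y) =
    (X `^ p + S * s `^ p) `^ p^-1.
  rewrite /= (bigD1 i)//=; congr (_ `^ _); congr (_ + _).
    by rewrite !mxE !eqxx mulr1 XE.
  rewrite mulr_suml; apply: eq_bigr => j ji; rewrite !mxE (negbTE ji) mulr0 add0r.
  by rewrite normrM powRM// mulrC (ger0_norm (ltW s0)).
set Y := _ `^ p^-1; move=> /andP[h1 h2].
have -> : Y - (a + s * t) = s * ((-1) ^+ b * y i 0 - t) + (Y - X).
  by rewrite /X; ring.
by rewrite !lerD2l -!mulrA ![_^-1 * _]mulrC h1 h2.
Qed.

(** In [vertex_gap], the upper contact bound with [r > 1] gives [D <= 0], and nonnegativity of the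
    gap with [p > 1] gives [D >= 0]. The lower contact bound then forces [S > 0], and the powers
    [s ^ p] and [s ^ r] bound each other. *)
Lemma contact_vertex {R : realType} {n : nat} (p r a : R) (ib : 'I_n * bool)
    (w : 'cV[R]_(1 + n)) : 1 < p -> 1 < r -> 0 < a ->
  contact p%:E r (a *: ray ib) w -> r = p.
Proof.
move=> p1 r1 a0; rewrite (pt_eta w); case: ib => i b.
set t := usubmx w 0 0; set y := dsubmx w => -[c [C [d [c0 d0 H]]]].
have [k [K [d' [k0 K0 d'0 /= H']]]] := vertex_gap p a t i b y p1 a0.
move: H'; set D := _ - t; set S := \sum_(_ < _ | _) _ => H'.
pose e := Num.min d d'.
have e0 : 0 < e by rewrite lt_min d0.
have G s : 0 < s < e -> s * D + k * S * s `^ p <= C * s `^ r /\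
    c * s `^ r <= s * D + K * S * s `^ p.
  rewrite lt_min => /and3P[s0 sd sd'].
  have /andP[h1 h2] : 0 < s < d by rewrite s0.
  have /H' /andP[h3 h4] : 0 < s < d' by rewrite s0.
  have /H /andP[h5 h6] : 0 < s < d by rewrite s0.
  by split; [exact: le_trans h6|exact: le_trans h4].
have S0 : 0 <= S by apply: sumr_ge0 => j _; exact: powR_ge0.
have D0 : D = 0.
  apply/eqP; rewrite eq_le; apply/andP; split.
    apply: (@le0_of_le_powR R D C e (r - 1)); rewrite ?subr_gt0// => s hs.
    have s0 : 0 < s by case/andP: hs.
    rewrite -(ler_pM2l s0) mulrCA mulr_powRB1 ?(ltW s0) ?(lt_trans _ r1)//.
    have [h _] := G s hs; apply: le_trans h.
    by rewrite lerDl !mulr_ge0 ?powR_ge0// ltW.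
  rewrite -oppr_le0; apply: (@le0_of_le_powR R (- D) (K * S) e (p - 1)); rewrite ?subr_gt0//.
  move=> s hs; have s0 : 0 < s by case/andP: hs.
  rewrite -(ler_pM2l s0) mulrCA mulr_powRB1 ?(ltW s0) ?(lt_trans _ p1)//.
  have [_ h] := G s hs; have : 0 <= c * s `^ r by rewrite mulr_ge0 ?powR_ge0// ltW.
  lra.
have {}G s : 0 < s < e -> k * S * s `^ p <= C * s `^ r /\ c * s `^ r <= K * S * s `^ p.
  by move=> /G; rewrite D0 mulr0 !add0r.
have Sgt0 : 0 < S.
  rewrite lt_def S0 andbT; apply/eqP => Sz.
  have hs : 0 < e / 2 < e by rewrite divr_gt0//= ltr_pdivrMr// ltr_pMr// ltr1n.
  have [_] := G _ hs; rewrite Sz mulr0 mul0r leNgt mulr_gt0 ?powR_gt0//.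
  by case/andP: hs.
apply/eqP; rewrite eq_le; apply/andP; split.
  apply: (@exponent_le R (k * S) C e) => //; first by rewrite mulr_gt0.
  by move=> s /G[].
by apply: (@exponent_le R c (K * S) e) => // s /G[].
Qed.

(** A vanishing gap forces [D = 0] and then [S = 0]: only coordinate [i] moves, and [D = 0] ties it
    to [t]. *)
Lemma flat_vertex {R : realType} {n : nat} (p a : R) (ib : 'I_n * bool)
    (w : 'cV[R]_(1 + n)) : 1 < p -> 0 < a ->
  flat p%:E (a *: ray ib) w -> exists c, w = c *: (a *: ray ib).
Proof.
move=> p1 a0; have p0 : 0 < p by apply: lt_trans p1.
rewrite (pt_eta w); case: ib => i b.
set t := usubmx w 0 0; set y := dsubmx w => -[d d0 H].
have [k [K [d' [k0 K0 d'0 /= H']]]] := vertex_gap p a t i b y p1 a0.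
move: H'; set D := _ - t; set S := \sum_(_ < _ | _) _ => H'.
pose e := Num.min d d'.
have e0 : 0 < e by rewrite lt_min d0.
have G s : 0 < s < e -> s * D + k * S * s `^ p <= 0 /\ 0 <= s * D + K * S * s `^ p.
  rewrite lt_min => /and3P[s0 sd sd'].
  have /H' /andP[] : 0 < s < d' by rewrite s0.
  by rewrite H ?s0.
have S0 : 0 <= S by apply: sumr_ge0 => j _; exact: powR_ge0.
have hs : 0 < e / 2 < e by rewrite divr_gt0//= ltr_pdivrMr// ltr_pMr// ltr1n.
have se0 : 0 < e / 2 by case/andP: hs.
have D0 : D = 0.
  apply/eqP; rewrite eq_le; apply/andP; split.
    rewrite -(pmulr_rle0 _ se0); have [h _] := G _ hs; apply: le_trans h.
    by rewrite lerDl !mulr_ge0 ?powR_ge0// ltW.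
  rewrite -oppr_le0; apply: (@le0_of_le_powR R (- D) (K * S) e (p - 1)); rewrite ?subr_gt0//.
  move=> s hs'; have s0 : 0 < s by case/andP: hs'.
  rewrite -(ler_pM2l s0) mulrCA mulr_powRB1 ?(ltW s0)//.
  have [_ h] := G s hs'; lra.
have Sz : S = 0.
  apply/eqP; rewrite eq_le S0 andbT.
  have [h _] := G _ hs; move: h; rewrite D0 mulr0 add0r.
  by rewrite pmulr_lle0 ?powR_gt0// pmulr_rle0.
have yE : y = y i 0 *: delta_mx i 0.
  apply: eq_scale_delta => j ji; move: Sz => /eqP.
  rewrite psumr_eq0 => [/allP/(_ j (mem_index_enum _))|? _]; last exact: powR_ge0.
  by rewrite ji /= => /eqP/powR_eq0_eq0/eqP; rewrite normr_eq0 => /eqP.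
exists (t / a); rewrite scalerA divfK ?gt_eqF// scale_ray {1}yE; congr (pt _ (_ *: _)).
move/eqP: D0; rewrite subr_eq0 => /eqP <-.
by rewrite mulrA -signr_addb addbb mul1r.
Qed.

(** Here [D = 0] and [S = 1] in [vertex_gap]. *)
Lemma contact_ray_axis {R : realType} {n : nat} (p : R) (i j : 'I_n) (b : bool) :
  1 < p -> j != i -> contact p%:E p (ray (i, b)) (pt 0 (delta_mx j 0)).
Proof.
move=> p1 ji; have p0 : 0 < p by apply: lt_trans p1.
have [k [K [d [k0 K0 d0 /= H]]]] := vertex_gap p 1 0 i b (delta_mx j 0) p1 ltr01.
exists k, K, d; split=> // s /H; rewrite scale1r.
rewrite mxE eq_sym (negbTE ji) mulr0 subr0 mulr0 !add0r.
rewrite (bigD1 j)//= big1 => [|l /andP[_ lj]]; last first.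
  by rewrite mxE (negbTE lj) normr0 powR0 ?gt_eqF.
by rewrite mxE !eqxx normr1 powR1 addr0 !mulr1.
Qed.

(** In the plane of coordinates [i] and [j] there is a direction along which the [p]-th power sum
    has no first-order term. Its increment is of order [s ^ 2] by [powR_second_order], and
    [root_increment] passes to the norm. *)
Lemma contact2_two {R : realType} {n : nat} (p : R) (x : 'cV[R]_n) (i j : 'I_n) :
  1 < p -> i != j -> x i 0 != 0 -> x j 0 != 0 ->
  exists w, contact p%:E 2 (pt (pnorm p%:E x) x) w.
Proof.
move=> p1 ij xi xj; have p0 : 0 < p by apply: lt_trans p1.
have [k [K [k0 K0 H]]] := powR_second_order p p1.
have [a a0 ni] : exists2 a, 0 < a & `|x i 0| `^ p = a^-1.
  by exists (`|x i 0| `^ p)^-1; rewrite ?invrK// invr_gt0 powR_gt0// normr_gt0.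
have [b b0 nj] : exists2 b, 0 < b & `|x j 0| `^ p = b^-1.
  by exists (`|x j 0| `^ p)^-1; rewrite ?invrK// invr_gt0 powR_gt0// normr_gt0.
move EN : (pnorm _ x) => N.
have N0 : 0 < N.
  rewrite lt_def -EN pnorm_ge0 andbT; apply: contra xi => /eqP/pnorm_eq0 ->.
    by rewrite mxE.
  by rewrite lee_fin ltW.
have T0 : 0 < N `^ p + K * (a + b).
  exact: addr_gt0 (powR_gt0 p N0) (mulr_gt0 K0 (addr_gt0 a0 b0)).
have [M M0 MpE] : exists2 M, 0 < M & M `^ p = N `^ p + K * (a + b).
  exists ((N `^ p + K * (a + b)) `^ p^-1); first exact: powR_gt0.
  by rewrite -powRrM mulVf ?gt_eqF// powRr1// ltW.
have := fun B => root_increment p N B N M p1 N0 (lexx _).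
set c1 := p * M `^ (p - 1); set c2 := p * N `^ (p - 1) => root_bound.
have c10 : 0 < c1 := mulr_gt0 p0 (powR_gt0 _ M0).
have c20 : 0 < c2 := mulr_gt0 p0 (powR_gt0 _ N0).
clearbody c1 c2.
(* Along [y], the first-order variations of [|x_i|^p] and [|x_j|^p] are [p * s] and
   [- p * s], so they cancel. *)
pose y : 'cV[R]_n := (a * x i 0) *: delta_mx i 0 - (b * x j 0) *: delta_mx j 0.
(* The last witness keeps [s * a] and [s * b] below 1/2, as [powR_second_order] requires, and [s]
   below 1. *)
exists (pt 0 y), (k * (a + b) / c1), (K * (a + b) / c2), (1 / (2 * (a + b + 1))).
have ab1 : 0 < a + b + 1 by rewrite !addr_gt0.
split.
- exact: divr_gt0 (mulr_gt0 k0 (addr_gt0 a0 b0)) c10.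
- by rewrite divr_gt0// mulr_gt0.
move=> s /andP[s0]; rewrite ltr_pdivlMr ?mulr_gt0// => hs.
have sa0 : 0 < s * a by rewrite mulr_gt0.
have sb0 : 0 < s * b by rewrite mulr_gt0.
have [sa sb s1] : [/\ s * a <= 2^-1, s * b <= 2^-1 & s <= 1] by split; lra.
have /andP[ha1 ha2] : k * (s * a) ^+ 2 <= (1 + s * a) `^ p - 1 - p * (s * a) <= K * (s * a) ^+ 2.
  by apply: H; rewrite ger0_norm// ltW.
have /andP[hb1 hb2] : k * (- (s * b)) ^+ 2 <= (1 - s * b) `^ p - 1 - p * (- (s * b)) <= K * (- (s * b)) ^+ 2.
  by apply: H; rewrite normrN ger0_norm// ltW.
(* The increment of the [p]-th power sum from [x] to [x + s *: y]. *)
pose B := ((1 + s * a) `^ p - 1) / a + ((1 - s * b) `^ p - 1) / b.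
have an0 : a != 0 by rewrite gt_eqF.
have bn0 : b != 0 by rewrite gt_eqF.
have BE : B = ((1 + s * a) `^ p - 1 - p * (s * a)) / a + ((1 - s * b) `^ p - 1 - p * (- (s * b))) / b.
  by rewrite /B; field; rewrite an0 bn0.
have sq (c : R) : c * (a + b) * s ^+ 2 = c * (s * a) ^+ 2 / a + c * (- (s * b)) ^+ 2 / b.
  by field; rewrite an0 bn0.
have B1 : k * (a + b) * s ^+ 2 <= B.
  by rewrite sq BE lerD// ler_pM2r// invr_gt0.
have B2 : B <= K * (a + b) * s ^+ 2.
  by rewrite sq BE lerD// ler_pM2r// invr_gt0.
have B0 : 0 <= B.
  by apply: le_trans B1; rewrite !mulr_ge0 ?exprn_ge0 ?addr_ge0// ltW.
have BM : N `^ p + B <= M `^ p.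
  rewrite MpE lerD2l (le_trans B2)// ler_piMr//.
    by rewrite mulr_ge0 ?addr_ge0// ltW.
  by rewrite exprn_ile1// ltW.
have := root_bound B B0 BM M0.
rewrite ptZ ptD gap_pt mulr0 addr0.
have -> : pnorm p%:E (x + s *: y) = (N `^ p + B) `^ p^-1.
  rewrite -EN pnorm_fin// [in LHS]/= (bigD1 i)//= (bigD1 j) 1?eq_sym//=.
  rewrite [in RHS](bigD1 i)//= [in RHS](bigD1 j) 1?eq_sym//=.
  have -> : (x + s *: y) i 0 = (1 + s * a) * x i 0.
    by rewrite !mxE !eqxx (negbTE ij)/= mulr1 mulr0 subr0; ring.
  have -> : (x + s *: y) j 0 = (1 - s * b) * x j 0.
    by rewrite !mxE !eqxx eq_sym (negbTE ij)/= mulr1 mulr0 sub0r; ring.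
  rewrite !normrM (@ger0_norm _ (1 + _)); last by lra.
  rewrite (@ger0_norm _ (1 - _)); last by lra.
  rewrite (powRM p _ (normr_ge0 _)); last by lra.
  rewrite (powRM p _ (normr_ge0 _)); last by lra.
  rewrite ni nj; congr (_ `^ _).
  rewrite (eq_bigr (fun l => `|x l 0| `^ p)) => [|l /andP[li lj]]; last first.
    by rewrite !mxE (negbTE li) (negbTE lj)/= !mulr0 subr0 mulr0 addr0.
  by rewrite /B; field; rewrite an0 bn0.
rewrite powR_mulrn ?(ltW s0)// => /andP[h1 h2]; apply/andP; split.
  apply: le_trans h1; rewrite mulrAC ler_pM2r ?invr_gt0//.
by apply: le_trans h2 _; rewrite [leRHS]mulrAC ler_pM2r ?invr_gt0.
Qed.

(** * Flat directions of the 1-cone and the oo-cone *)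

Lemma pnorm1 {R : realType} {n : nat} (x : 'cV[R]_n) : pnorm 1%:E x = \sum_i `|x i 0|.
Proof.
rewrite /= invr1 powRr1; last by apply: sumr_ge0 => i _; exact: powR_ge0.
by apply: eq_bigr => i _; rewrite powRr1.
Qed.

Lemma pnorm_infty_le {R : realType} {n : nat} (x : 'cV[R]_n) (a : R) :
  0 <= a -> (forall i, `|x i 0| <= a) -> pnorm +oo%E x <= a.
Proof. by move=> a0 h; apply: bigmax_le. Qed.

Lemma le_pnorm_infty {R : realType} {n : nat} (x : 'cV[R]_n) (i : 'I_n) :
  `|x i 0| <= pnorm +oo%E x.
Proof. exact: (le_bigmax 0 (fun i => `|x i 0|)). Qed.

Lemma ord_neq {n : nat} (i : 'I_n) : (2 <= n)%N -> exists j : 'I_n, j != i.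
Proof.
move=> hn; have : (1 < #|'I_n|)%N by rewrite card_ord.
move=> /card_gt1P[j [k [_ _ jk]]].
have [ji|] := eqVneq j i; last by exists j.
by exists k; rewrite -ji eq_sym.
Qed.

Lemma norm_sign_add {R : realType} (x s : R) : 0 < s ->
  `|x + s * (-1) ^+ (x < 0)%R| = `|x| + s.
Proof.
by move=> s0; case: (ltP x 0) => hx /=; rewrite ?expr1 ?expr0 ?mulr1 ?mulrN1;
  [rewrite !ltr0_norm//; lra|rewrite !ger0_norm//; lra].
Qed.

(** With [x i 0] nonzero and [j != i], pushing coordinate [j] away from 0 raises the norm at the
    same rate as [t]. This direction has zero coordinate [i], so it is not parallel to [v]. *)
Lemma flat_1 {R : realType} {n : nat} (v : 'cV[R]_(1 + n)) : (2 <= n)%N -> v != 0 ->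
  gap 1%:E v = 0 -> exists2 w, flat 1%:E v w & forall c, w != c *: v.
Proof.
move=> hn v0; rewrite (pt_eta v) in v0 *; move: v0.
set t := usubmx v 0 0; set x := dsubmx v; clearbody t x => v0.
rewrite gap_pt => /eqP; rewrite subr_eq0 => /eqP tE; rewrite -tE in v0 *.
have [i xi] : exists i, x i 0 != 0.
  apply/existsP; apply: contraNT v0 => /existsPn x0.
  rewrite pnorm1 big1 => [|i _]; last by have := x0 i; rewrite negbK => /eqP ->; rewrite normr0.
  apply/eqP; rewrite -pt0; congr pt.
  by apply/matrixP => k l; rewrite ord1 [RHS]mxE; have := x0 k; rewrite negbK => /eqP.
have [j ji] := ord_neq i hn.
exists (ray (j, x j 0 < 0)).
  exists 1 => // s /andP[s0 _]; rewrite scale_ray ptD gap_pt !pnorm1.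
  rewrite (bigD1 j)//= [in X in _ - X](bigD1 j)//= !mxE !eqxx mulr1.
  rewrite (mulrC _ s) norm_sign_add//.
  rewrite (eq_bigr (fun l => `|x l 0|)) => [|l lj]; last first.
    by rewrite !mxE (negbTE lj) mulr0 addr0.
  by ring.
move=> c; apply/eqP; rewrite /ray ptZ => /pt_inj[c1 /matrixP/(_ i 0)/esym/eqP].
rewrite !mxE (eq_sym i j) (negbTE ji) mulr0 mulf_eq0 (negbTE xi) orbF => /eqP c0.
by move/eqP: c1; rewrite c0 mul0r oner_eq0.
Qed.

(** Pushing a coordinate of maximal modulus away from 0 raises the norm at unit rate, provided the
    others move no faster. *)
Lemma flat_infty {R : realType} {n : nat} (v : 'cV[R]_(1 + n)) : (2 <= n)%N -> v != 0 ->
  gap +oo%E v = 0 -> exists2 w, flat +oo%E v w & forall c, w != c *: v.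
Proof.
move=> hn v0; rewrite (pt_eta v) in v0 *; move: v0.
set t := usubmx v 0 0; set x := dsubmx v; clearbody t x => v0.
rewrite gap_pt => /eqP; rewrite subr_eq0 => /eqP tE; rewrite -tE in v0 *.
have n0 : (0 < n)%N by exact: leq_trans hn.
set N := pnorm _ x.
have [i Ni] : exists i, N = `|x i 0|.
  by eexists; rewrite /N /= (@bigmax_eq_arg _ _ _ _ (Ordinal n0)).
have N0 : 0 < N.
  rewrite lt_def pnorm_ge0 andbT; apply: contra v0 => /eqP Nz.
  by rewrite -/N Nz (pnorm_eq0 _ _ _ Nz) ?leey// pt0.
have [j ji] := ord_neq i hn.
(* Coordinate [j] of [y] is nonzero exactly when that of [x] is zero, which rules out
   parallelism. *)
pose y : 'cV[R]_n := (-1) ^+ (x i 0 < 0)%R *: delta_mx i 0 + (x j 0 == 0)%:R *: delta_mx j 0.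
exists (pt 1 y).
  exists 1 => // s /andP[s0 _]; rewrite ptZ ptD gap_pt mulr1.
  apply/eqP; rewrite subr_eq0 eq_le; apply/andP; split; last first.
    apply: le_trans (le_pnorm_infty _ i).
    rewrite !mxE !eqxx (eq_sym i j) (negbTE ji)/= mulr1 mulr0 addr0 norm_sign_add//.
    by rewrite -Ni.
  apply: pnorm_infty_le => [|l]; first by rewrite addr_ge0 ?pnorm_ge0// ltW.
  have := le_pnorm_infty x l; rewrite -/N !mxE !eqxx !andbT.
  have [->|li] := eqVneq l i.
    rewrite (eq_sym i j) (negbTE ji)/= mulr1 mulr0 addr0 norm_sign_add//.
    by rewrite lerD2r.
  rewrite mulr0 add0r; have [->|lj] := eqVneq l j; last first.
    by rewrite mulr0 mulr0 addr0 => /le_trans-> //; rewrite lerDl ltW.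
  have [->|xj] := eqVneq (x j 0) 0.
    by rewrite add0r !mulr1 => _; rewrite gtr0_norm// lerDr ltW.
  by rewrite mul0r mulr0 addr0 => /le_trans-> //; rewrite lerDl ltW.
move=> c; apply/eqP; rewrite ptZ => /pt_inj[c1 /matrixP/(_ j 0)].
rewrite !mxE !eqxx (negbTE ji) mulr0 add0r mulr1.
have [->/eqP|xj /esym/eqP] := eqVneq (x j 0) 0; first by rewrite mulr0 oner_eq0.
rewrite mulf_eq0 (negbTE xj) orbF => /eqP c0.
by move/eqP: c1; rewrite c0 mul0r oner_eq0.
Qed.

(** * Consequences for isomorphisms *)

Lemma double_lt_exp2 (n : nat) : (3 <= n)%N -> (2 * n < 2 ^ n)%N.
Proof.
elim: n => // n IH; rewrite leq_eqVlt => /predU1P[<-//|n3].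
have h := IH n3; move: n3; rewrite expnS; lia.
Qed.

Section Isomorphisms.
Context {R : realType} {n : nat}.
Implicit Types (A B M N : 'M[R]_(1 + n)) (z w u v : 'cV[R]_(1 + n)).

Lemma gap_ray (p : R) (ib : 'I_n * bool) : 0 < p -> gap p%:E (ray ib : 'cV[R]_(1 + n)) = 0.
Proof. by move=> p0; rewrite gap_pt pnorm_delta// normr_sign subrr. Qed.

Lemma cone_iso_neq0 (p q : \bar R) A B v : cone_iso p q A B -> v != 0 -> A *m v != 0.
Proof.
move=> [_ BA _ _]; apply: contra => /eqP e.
by rewrite -[v]mul1mx -BA -mulmxA e mulmx0.
Qed.

Lemma cone_isoK (p q : \bar R) A B v : cone_iso p q A B -> B *m (A *m v) = v.
Proof. by move=> [_ BA _ _]; rewrite mulmxA BA mul1mx. Qed.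

(** If the image is not a vertex, it has two nonzero coordinates and a contact of order 2; pulled
    back to the vertex, this order must be [p]. *)
Lemma cone_iso_ray (p q : R) A B (ib : 'I_n * bool) : 1 < p -> 1 < q ->
  cone_iso p%:E q%:E A B ->
  (exists2 a, 0 < a & exists jb, A *m ray ib = a *: ray jb) \/ p = 2.
Proof.
move=> p1 q1 h.
have p0 : 0 < p by apply: lt_trans p1.
have hp : (1%:E <= p%:E)%E by rewrite lee_fin ltW.
have hq : (1%:E <= q%:E)%E by rewrite lee_fin ltW.
have v0 := cone_iso_neq0 _ _ _ _ _ h (ray_neq0 ib).
have gv := gap_eq0 _ _ _ _ _ hp hq h (gap_ray p ib p0).
have [|[x [i [j [vE ij xi xj]]]]] := gap0_ray_or_two q _ q1 v0 gv; first by left.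
right; have [w] := contact2_two q x i j q1 ij xi xj; rewrite -vE.
move=> /(contact_iso _ _ _ _ _ _ _ hq hp (cone_iso_sym _ _ _ _ h)).
rewrite (cone_isoK _ _ _ _ _ h) -[ray ib]scale1r => /contact_vertex ->//.
by rewrite ltr1n.
Qed.

(** Order [p] occurs at a vertex. If the image is again a vertex, the order there can only be
    [q]. *)
Lemma cone_iso_exponent (p q : R) A B : (2 <= n)%N -> 1 < p -> 1 < q ->
  cone_iso p%:E q%:E A B -> p = q \/ p = 2.
Proof.
move=> hn p1 q1 h.
have hp : (1%:E <= p%:E)%E by rewrite lee_fin ltW.
have hq : (1%:E <= q%:E)%E by rewrite lee_fin ltW.
pose i : 'I_n := Ordinal (ltnW hn); have [j ji] := ord_neq i hn.
have [[a a0 [jb e]]|] := cone_iso_ray p q A B (i, false) p1 q1 h; last by right.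
left; have := contact_ray_axis p i j false p1 ji.
by move=> /(contact_iso _ _ _ _ _ _ _ hp hq h); rewrite e => /contact_vertex; apply.
Qed.

(** [B] sends a vertex to a boundary point of the p-cone; a flat direction there that is not
    parallel to it would return under [A] to contradict [flat_vertex]. *)
Lemma flat_cone_not_iso (p : \bar R) (q : R) A B : (0 < n)%N -> (1%:E <= p)%E -> 1 < q ->
  (forall v, v != 0 -> gap p v = 0 -> exists2 w, flat p v w & forall c, w != c *: v) ->
  ~ cone_iso p q%:E A B.
Proof.
move=> hn hp q1 H h; have h' := cone_iso_sym _ _ _ _ h.
have q0 : 0 < q by apply: lt_trans q1.
have hq : (1%:E <= q%:E)%E by rewrite lee_fin ltW.
pose r : 'cV[R]_(1 + n) := ray (Ordinal hn, false).
have [w fw nw] := H _ (cone_iso_neq0 _ _ _ _ _ h' (ray_neq0 _))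
  (gap_eq0 _ _ _ _ _ hq hp h' (gap_ray q (Ordinal hn, false) q0)).
have := flat_iso _ _ _ _ _ _ hp hq h fw; rewrite (cone_isoK _ _ _ _ _ h').
rewrite -/r -[r]scale1r => /flat_vertex -/(_ q1 ltr01)[c]; rewrite scale1r => e.
by have /eqP := nw c; apply; rewrite -(cone_isoK _ _ _ _ w h) e scalemxAr.
Qed.

(** * Generation of the 1-cone by the vertex rays *)

Lemma cone1_ind (P : 'cV[R]_(1 + n) -> Prop) : (0 < n)%N ->
  (forall u v, P u -> P v -> P (u + v)) -> (forall a v, 0 <= a -> P v -> P (a *: v)) ->
  (forall ib, P (ray ib)) -> forall z, gap 1%:E z <= 0 -> P z.
Proof.
move=> hn PD PZ Pr z.
have P0 : P 0 by rewrite -(scale0r (ray (Ordinal hn, false))); exact: PZ.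
have Pe : P (pt 1 0).
  have -> : pt 1 0 = 2^-1 *: (ray (Ordinal hn, false) + ray (Ordinal hn, true)) :> 'cV[R]_(1 + n).
    rewrite /ray ptD ptZ /= expr0 expr1 scale1r scaleN1r subrr scaler0; congr pt.
    by field.
  by apply: PZ; [rewrite invr_ge0|exact: PD].
rewrite (pt_eta z); move: (usubmx z 0 0) (dsubmx z) => t x {z}.
rewrite gap_pt subr_le0 => xt.
(* The excess of [t] over the norm goes to the axis, and [x] splits coordinatewise with matching
   signs. *)
have -> : pt t x = (t - pnorm 1%:E x) *: pt 1 0 + \sum_i `|x i 0| *: ray (i, x i 0 < 0).
  have -> : \sum_i `|x i 0| *: ray (i, x i 0 < 0) = pt (pnorm 1%:E x) x :> 'cV[R]_(1 + n).
    under eq_bigr do rewrite scale_ray -numEsign.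
    by rewrite pt_sum col_sum_delta pnorm1.
  by rewrite ptZ ptD mulr1 scaler0 add0r subrK.
apply: (PD); first by apply: (PZ) => //; rewrite subr_ge0.
by apply: (big_ind P P0 PD) => i _; exact: PZ.
Qed.

Lemma ray_map_cone1 A : (0 < n)%N ->
  (forall ib, exists2 a, 0 < a & exists jb, A *m ray ib = a *: ray jb) ->
  forall z, gap 1%:E z <= 0 -> gap 1%:E (A *m z) <= 0.
Proof.
move=> hn H; apply: (cone1_ind _ hn) => [u v hu hv|a v a0 hv|ib].
- by rewrite mulmxDr (le_trans (gapD _ _ _ _))// -[leRHS]addr0 lerD.
- by rewrite -scalemxAr gapZ// mulr_ge0_le0.
- have [a a0 [jb ->]] := H ib.
  by rewrite gapZ ?(ltW a0)// gap_ray// mulr0.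
Qed.

Lemma cone_iso_cone1 (p : R) A B : (0 < n)%N -> 1 < p -> p <> 2 ->
  cone_iso p%:E p%:E A B -> cone_iso 1%:E 1%:E A B.
Proof.
move=> hn p1 p2 h; have h' := cone_iso_sym _ _ _ _ h.
case: (h) => AB BA _ _; split=> //; apply: ray_map_cone1 => // ib.
  by have [|//] := cone_iso_ray p p A B ib p1 p1 h.
by have [|//] := cone_iso_ray p p B A ib p1 p1 h'.
Qed.

(** * Duality between the 1-cone and the oo-cone *)

Lemma cone1_dual z : gap 1%:E z <= 0 <->
  (forall v, gap +oo%E v <= 0 -> 0 <= (z^T *m v) 0 0).
Proof.
have dotE (t u : R) (x y : 'cV[R]_n) :
    ((pt t x)^T *m pt u y) 0 0 = t * u + \sum_i x i 0 * y i 0.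
  rewrite /pt tr_col_mx mul_row_col !mxE big_ord1 !mxE !eqxx !mulr1n.
  by congr (_ + _); apply: eq_bigr => i _; rewrite mxE.
rewrite (pt_eta z); move: (usubmx z 0 0) (dsubmx z) => t x {z}.
rewrite gap_pt subr_le0 pnorm1; split.
  move=> xt v; rewrite (pt_eta v); move: (usubmx v 0 0) (dsubmx v) => u y {v}.
  rewrite gap_pt subr_le0 dotE => yu.
  have u0 : 0 <= u by apply: le_trans yu; exact: pnorm_ge0.
  have : \sum_i - (x i 0 * y i 0) <= \sum_i `|x i 0| * u.
    apply: ler_sum => i _; rewrite (le_trans (ler_norm _))// normrN normrM ler_wpM2l//.
    exact: le_trans (le_pnorm_infty y i) yu.
  rewrite sumrN -mulr_suml => h1.
  have := ler_wpM2r u0 xt; lra.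
move=> /(_ (pt 1 (\col_i - (-1) ^+ (x i 0 < 0)%R))).
rewrite gap_pt subr_le0 dotE mulr1 => H.
rewrite -subr_ge0 -sumrN; apply: le_trans (H _) _.
  by apply: pnorm_infty_le => // i; rewrite mxE normrN normr_sign.
rewrite lerD2l ler_sum// => i _; rewrite mxE mulrN lerN2.
by rewrite normrEsign mulrC.
Qed.

(** Pairing [A^T *m z] with [v] is pairing [z] with [A *m v], so [cone1_dual] applies. *)
Lemma cone1_tr A : (forall z, gap +oo%E z <= 0 -> gap +oo%E (A *m z) <= 0) ->
  forall z, gap 1%:E z <= 0 -> gap 1%:E (A^T *m z) <= 0.
Proof.
move=> h z /cone1_dual hz; apply/cone1_dual => v /h /hz.
by rewrite trmx_mul trmxK mulmxA.
Qed.

Lemma cone_iso_tr A B : cone_iso +oo%E +oo%E A B -> cone_iso 1%:E 1%:E A^T B^T.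
Proof.
move=> [AB BA hA hB]; split.
- by rewrite -trmx_mul BA trmx1.
- by rewrite -trmx_mul AB trmx1.
- exact: cone1_tr.
- exact: cone1_tr.
Qed.

(** * Extreme rays *)

Definition extreme (p : \bar R) v : Prop :=
  [/\ v != 0, gap p v <= 0 & forall u w, gap p u <= 0 -> gap p w <= 0 ->
    v = u + w -> exists c, u = c *: v].

Lemma extreme_iso (p q : \bar R) A B v : cone_iso p q A B ->
  extreme p v -> extreme q (A *m v).
Proof.
move=> h [v0 gv hv]; split; first exact: cone_iso_neq0 h v0.
  by case: h => _ _ hA _; exact: hA.
move=> u w gu gw e; case: (h) => AB BA hA hB.
have [|c hc] := hv _ _ (hB _ gu) (hB _ gw).
  by rewrite -mulmxDr -e mulmxA BA mul1mx.
by exists c; rewrite scalemxAr -hc mulmxA AB mul1mx.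
Qed.

(** It suffices to subtract a nonzero multiple of a vertex without leaving the cone, since
    extremality makes it proportional to [v]. If [x i 0] is nonzero, the multiple is its modulus; if
    [x = 0], it is [t / 2], and the opposite vertex accounts for the rest. *)
Lemma extreme1_ray v : (0 < n)%N -> extreme 1%:E v ->
  exists2 a, 0 < a & exists ib, v = a *: ray ib.
Proof.
move=> hn [v0 gv hv].
suff [c [ib e]] : exists c ib, v = c *: ray ib.
  exists c; last by exists ib.
  have cn0 : c != 0 by apply: contra v0 => /eqP c0; rewrite e c0 scale0r.
  rewrite lt_def cn0; move: gv; rewrite e /ray ptZ gap_pt mulr1 subr_le0.
  by apply: le_trans; exact: pnorm_ge0.
have step u a ib : u = a *: ray ib -> a != 0 -> gap 1%:E u <= 0 -> gap 1%:E (v - u) <= 0 ->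
    exists c jb, v = c *: ray jb.
  move=> uE a0 gu gvu; have [|c uv] := hv u (v - u) gu gvu; first by rewrite subrKC.
  have c0 : c != 0.
    apply: contra a0 => /eqP c0; move: uv; rewrite c0 scale0r uE => /eqP.
    by rewrite scaler_eq0 (negbTE (ray_neq0 ib)) orbF.
  by exists (c^-1 * a), ib; rewrite -scalerA -uE uv scalerA mulVf// scale1r.
have rp (a : R) ib : 0 <= a -> gap 1%:E (a *: ray ib : 'cV[R]_(1 + n)) <= 0.
  by move=> a0; rewrite gapZ// gap_ray// mulr0.
move: step gv v0; rewrite (pt_eta v); move: (usubmx v 0 0) (dsubmx v) => t x step gv v0.
move: (gv); rewrite gap_pt subr_le0 => xt.
have t0 : 0 <= t by apply: le_trans xt; exact: pnorm_ge0.
have [x0|/existsP[i xi]] := boolP [forall i, x i 0 == 0].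
  have {}x0 : x = 0 by apply/matrixP => i j; rewrite ord1 mxE; apply/eqP; exact: (forallP x0).
  move: step v0; rewrite x0 => step v0.
  have tn0 : t != 0 by apply: contra v0 => /eqP ->; rewrite pt0.
  have th : 0 <= t / 2 by rewrite divr_ge0.
  apply: (step _ (t / 2) (Ordinal hn, false) erefl); rewrite ?mulf_neq0// ?invr_eq0 ?rp//.
  rewrite (_ : _ - _ = (t / 2) *: ray (Ordinal hn, true)) ?rp//.
  rewrite !scale_ray -scaleN1r ptZ ptD add0r scalerA; congr (pt _ (_ *: _)); first by field.
  by rewrite /= expr0 expr1; ring.
apply: (step _ `|x i 0| (i, x i 0 < 0) erefl); rewrite ?normr_eq0 ?rp//.
rewrite scale_ray -numEsign -scaleN1r ptZ ptD gap_pt pnorm1.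
rewrite (bigD1 i)//= !mxE !eqxx mulr1 mulN1r subrr normr0 add0r.
rewrite (eq_bigr (fun j => `|x j 0|)) => [|j ji]; last first.
  by rewrite !mxE (negbTE ji) mulr0 mulr0 addr0.
by move: xt; rewrite pnorm1 (bigD1 i)//=; lra.
Qed.

(** The signed coordinates [i] of the summands add up to 1, as do [t] and [t'], leaving no room for
    the other coordinates. *)
Lemma ray_extreme1 (ib : 'I_n * bool) : extreme 1%:E (ray ib).
Proof.
split; [exact: ray_neq0|by rewrite gap_ray|].
case: ib => i b u w; rewrite (pt_eta u) (pt_eta w).
move: (usubmx u 0 0) (dsubmx u) (usubmx w 0 0) (dsubmx w) => t x t' x' {u w}.
rewrite !gap_pt !subr_le0 !pnorm1 (bigD1 i)//= [in X in _ -> X -> _](bigD1 i)//=.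
set S := \sum_(_ < n | _) _; set S' := \sum_(_ < n | _) _ => h h'.
rewrite ptD /ray => /pt_inj/=[tt' xx'].
have S0 : 0 <= S by apply: sumr_ge0.
have S'0 : 0 <= S' by apply: sumr_ge0.
have e : (-1) ^+ b * x i 0 + (-1) ^+ b * x' i 0 = 1.
  have /matrixP/(_ i 0) := xx'; rewrite !mxE !eqxx mulr1 -mulrDr => <-.
  by rewrite -signr_addb addbb.
have n1 : (-1) ^+ b * x i 0 <= `|x i 0|.
  by rewrite (le_trans (ler_norm _))// normrM normr_sign mul1r.
have n2 : (-1) ^+ b * x' i 0 <= `|x' i 0|.
  by rewrite (le_trans (ler_norm _))// normrM normr_sign mul1r.
have Sz : S = 0 by lra.
have te : t = (-1) ^+ b * x i 0 by lra.
exists t; rewrite -/(ray (i, b)) scale_ray; congr pt.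
rewrite te mulrA -signr_addb addbb mul1r; apply: eq_scale_delta => j ji.
move/eqP: Sz; rewrite psumr_eq0// => /allP/(_ j (mem_index_enum _)).
by rewrite ji /= normr_eq0 => /eqP.
Qed.

(** Each signed coordinate is at most [t], respectively [t'], and both pairs add up to 1, so
    equality holds in every coordinate. *)
Lemma sign_extreme_infty (f : 'I_n -> bool) : extreme +oo%E (pt 1 (\col_i (-1) ^+ f i)).
Proof.
split.
- by apply/eqP; rewrite -pt0 => /pt_inj[/eqP]; rewrite oner_eq0.
- by rewrite gap_pt subr_le0; apply: pnorm_infty_le => // i; rewrite mxE normr_sign.
move=> u w; rewrite (pt_eta u) (pt_eta w).
move: (usubmx u 0 0) (dsubmx u) (usubmx w 0 0) (dsubmx w) => t x t' x' {u w}.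
rewrite !gap_pt !subr_le0 ptD => h h' /pt_inj[tt' xx'].
exists t; rewrite ptZ mulr1; congr pt; apply/matrixP => i j; rewrite ord1 !mxE.
have n1 : (-1) ^+ f i * x i 0 <= t.
  rewrite (le_trans (ler_norm _))// normrM normr_sign mul1r.
  exact: le_trans (le_pnorm_infty x i) h.
have n2 : (-1) ^+ f i * x' i 0 <= t'.
  rewrite (le_trans (ler_norm _))// normrM normr_sign mul1r.
  exact: le_trans (le_pnorm_infty x' i) h'.
have e : (-1) ^+ f i * x i 0 + (-1) ^+ f i * x' i 0 = 1.
  have /matrixP/(_ i 0) := xx'; rewrite !mxE -mulrDr => <-.
  by rewrite -signr_addb addbb.
have -> : t = (-1) ^+ f i * x i 0 by lra.
by rewrite mulrAC -signr_addb addbb mul1r.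
Qed.

(** [B] would map the [2 ^ n] sign vectors to vertex rays injectively, but there are only [2 * n] of
    these. *)
Lemma cone1_not_iso_infty A B : (3 <= n)%N -> ~ cone_iso 1%:E +oo%E A B.
Proof.
move=> hn h; have h' := cone_iso_sym _ _ _ _ h.
pose v (f : {ffun 'I_n -> bool}) : 'cV[R]_(1 + n) := pt 1 (\col_i (-1) ^+ f i).
have n0 : (0 < n)%N by apply: leq_trans hn.
have /choice[g gP] : forall f, exists ib, exists2 a, 0 < a & B *m v f = a *: ray ib.
  move=> f; have [a a0 [ib e]] := extreme1_ray _ n0 (extreme_iso _ _ _ _ _ h' (sign_extreme_infty f)).
  by exists ib, a.
have gI : injective g.
  move=> f f' ff'; have [a a0 e] := gP f; have [a' a'0 e'] := gP f'.
  have : B *m v f = (a / a') *: (B *m v f').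
    by rewrite e e' ff' scalerA divfK// gt_eqF.
  move=> /(congr1 (mulmx A)); rewrite -scalemxAr !(cone_isoK _ _ _ _ _ h') /v ptZ mulr1.
  move=> /pt_inj[<-]; rewrite scale1r => /matrixP E.
  by apply/ffunP => i; have := E i 0; rewrite !mxE => /signr_inj.
have := leq_card g gI; rewrite card_ffun card_prod card_bool card_ord leqNgt => /negP; apply.
by rewrite mulnC; exact: double_lt_exp2.
Qed.

(** [M] permutes extreme rays, which makes it a positive multiple of a signed permutation of the
    coordinates of [x] that scales [t] by the same factor. *)
Lemma cone1_aut_infty M N : (2 <= n)%N -> cone_iso 1%:E 1%:E M N ->
  forall z, gap +oo%E z <= 0 -> gap +oo%E (M *m z) <= 0.
Proof.
move=> hn h.
have n0 : (0 < n)%N by apply: leq_trans hn.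
have /choice[rho rhoP] : forall ib : 'I_n * bool, exists r : R * ('I_n * bool),
    0 < r.1 /\ M *m ray ib = r.1 *: ray r.2.
  move=> ib.
  have [a a0 [jb e]] := extreme1_ray _ n0 (extreme_iso _ _ _ _ _ h (ray_extreme1 ib)).
  by exists (a, jb).
(* The images of [ray (i, false)] and [ray (i, true)] have an interior sum, so they are
   opposite vertices over the same coordinate [k i]; comparing these sums for two values
   of [i] shows that all scaling factors agree. *)
pose k i := (rho (i, false)).2.1; pose s i := (rho (i, false)).2.2.
pose a i := (rho (i, false)).1; pose a' i := (rho (i, true)).1.
have Mf i : M *m ray (i, false) = a i *: ray (k i, s i).
  by have [_ ->] := rhoP (i, false); rewrite /k /s -surjective_pairing.
have a0 i : 0 < a i by have [] := rhoP (i, false).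
have a'0 i : 0 < a' i by have [] := rhoP (i, true).
have Me i : M *m ray (i, false) + M *m ray (i, true) = 2 *: (M *m pt 1 0).
  rewrite -mulmxDr scalemxAr; congr (_ *m _).
  rewrite /ray ptD ptZ /= expr0 expr1 scale1r scaleN1r subrr scaler0; congr pt.
  by rewrite mulr1.
have Mt i : M *m ray (i, true) = a' i *: ray (k i, ~~ s i).
  have [_] := rhoP (i, true); rewrite -/(a' i); case E : (rho (i, true)).2 => [l r] Mt.
  have : gap 1%:E (2 *: (M *m pt 1 0)) < 0.
    by rewrite gapZ// pmulr_rlt0//; exact: gap_apex_lt0 h.
  rewrite -(Me i) Mf Mt; have [<-|kl] := eqVneq (k i) l.
    have [->//|rs] := eqVneq r (~~ s i).
    have -> : r = s i by move: rs; case: (r) (s i) => -[].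
    by rewrite -scalerDl gapZ ?addr_ge0 ?(ltW (a0 i)) ?(ltW (a'0 i))// gap_ray// mulr0 ltxx.
  rewrite !scale_ray ptD gap_pt pnorm1.
  rewrite (bigD1 (k i))//= (bigD1 l) 1?eq_sym//= big1 => [|j /andP[jk jl]]; last first.
    by rewrite !mxE (negbTE jk) (negbTE jl) !mulr0 addr0 normr0.
  rewrite !mxE !eqxx (eq_sym l) (negbTE kl)/= !mulr1 !mulr0 !addr0 add0r.
  by rewrite !normrM !normr_sign !mul1r !gtr0_norm// subrr ltxx.
have kI : injective k.
  move=> i j kij; apply/eqP/negPn/negP => ij.
  have [b _ [c e]] : exists2 b, 0 < b & exists c, M *m ray (i, false) = b *: (M *m ray (j, c)).
    rewrite Mf kij; have [->|sij] := eqVneq (s i) (s j).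
      exists (a i / a j); first exact: divr_gt0.
      by exists false; rewrite Mf scalerA divfK ?gt_eqF.
    exists (a i / a' j); first exact: divr_gt0.
    exists true; rewrite Mt scalerA divfK ?gt_eqF//; congr (_ *: ray (_, _)).
    by move: sij; case: (s i) (s j) => -[].
  move/(congr1 (mulmx N)): e; rewrite -scalemxAr !(cone_isoK _ _ _ _ _ h).
  rewrite /ray ptZ => /pt_inj[_ /matrixP/(_ i 0)/esym/eqP].
  by rewrite !mxE !eqxx (negbTE ij) !mulr0 /= expr0 mulr1 eq_sym oner_eq0.
have Mpt i : 2 *: (M *m pt 1 0) = pt (a i + a' i) (((-1) ^+ s i * (a i - a' i)) *: delta_mx (k i) 0).
  rewrite -(Me i) Mf Mt !scale_ray ptD; congr pt; rewrite -scalerDl; congr (_ *: _).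
  by case: (s i); rewrite /= ?expr0 ?expr1; ring.
have aa' i : a' i = a i.
  (* The same vector is supported on coordinate [k i] and on coordinate [k j], so its coordinate
     [k i] vanishes. *)
  have [j ji] := ord_neq i hn.
  have := Mpt i; rewrite (Mpt j) => /pt_inj[_ /matrixP/(_ (k i) 0)/esym/eqP].
  rewrite !mxE !eqxx (inj_eq kI) (eq_sym i j) (negbTE ji) mulr0 mulr1 mulf_eq0 signr_eq0/=.
  by rewrite subr_eq0 => /eqP.
have [c c0 ac] : exists2 c, 0 < c & forall i, a i = c.
  exists (a (Ordinal n0)) => // i.
  have := Mpt i; rewrite (Mpt (Ordinal n0)) => /pt_inj[]; rewrite !aa' => e _; lra.
have M0 : M *m pt 1 0 = pt c 0.
  apply: (@scalerI _ _ 2); first by rewrite pnatr_eq0.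
  rewrite (Mpt (Ordinal n0)) aa' subrr mulr0 scale0r ac ptZ scaler0; congr pt; ring.
have Mi i : M *m pt 0 (delta_mx i 0) = pt 0 (((-1) ^+ s i * c) *: delta_mx (k i) 0).
  have -> : pt 0 (delta_mx i 0) = ray (i, false) - pt 1 0 :> 'cV[R]_(1 + n).
    by rewrite -scaleN1r ptZ ptD mulr1 subrr scaler0 addr0 /= expr0 scale1r.
  rewrite mulmxBr M0 Mf scale_ray ac -[- pt _ _]scaleN1r ptZ ptD scaler0 addr0; congr pt; ring.
move=> z; rewrite (pt_eta z); move: (usubmx z 0 0) (dsubmx z) => t x {z}.
rewrite gap_pt subr_le0 => xt.
have -> : M *m pt t x = pt (c * t) (\sum_i ((-1) ^+ s i * c * x i 0) *: delta_mx (k i) 0).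
  have -> : pt t x = t *: pt 1 0 + \sum_i x i 0 *: pt 0 (delta_mx i 0) :> 'cV[R]_(1 + n).
    have -> : \sum_i x i 0 *: pt 0 (delta_mx i 0) = pt 0 x :> 'cV[R]_(1 + n).
      by under eq_bigr do rewrite ptZ mulr0; rewrite pt_sum col_sum_delta big1.
    by rewrite ptZ ptD mulr1 addr0 scaler0 add0r.
  rewrite mulmxDr -scalemxAr M0 mulmx_sumr.
  have -> : \sum_i M *m (x i 0 *: pt 0 (delta_mx i 0)) =
      pt 0 (\sum_i ((-1) ^+ s i * c * x i 0) *: delta_mx (k i) 0).
    under eq_bigr do rewrite -scalemxAr Mi ptZ mulr0 scalerA (mulrC (x _ 0)).
    by rewrite pt_sum big1.
  by rewrite ptZ ptD scaler0 addr0 add0r mulrC.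
have t0 : 0 <= t by apply: le_trans xt; exact: pnorm_ge0.
rewrite gap_pt subr_le0; apply: pnorm_infty_le => [|l]; first by rewrite mulr_ge0// ltW.
rewrite summxE; have [/existsP[i /eqP il]|/existsPn nl] := boolP [exists i, k i == l].
  rewrite (bigD1 i)//= big1 => [|j ji]; last first.
    by rewrite !mxE -il (inj_eq kI) eq_sym (negbTE ji) mulr0.
  rewrite !mxE il !eqxx mulr1 addr0 !normrM normr_sign mul1r gtr0_norm// ler_wpM2l ?(ltW c0)//.
  exact: le_trans (le_pnorm_infty x i) xt.
rewrite big1 ?normr0 ?mulr_ge0 ?(ltW c0)// => i _.
by rewrite !mxE eq_sym (negbTE (nl i)) mulr0.
Qed.

(** [A^T] is an automorphism of the 1-cone, hence preserves the oo-cone; dualizing once more, [A]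
    preserves the 1-cone. *)
Lemma cone_iso_infty_cone1 A B : (2 <= n)%N ->
  cone_iso +oo%E +oo%E A B -> cone_iso 1%:E 1%:E A B.
Proof.
move=> hn h; have ht := cone_iso_tr _ _ h.
have ht' := cone_iso_sym _ _ _ _ ht.
case: h => AB BA _ _; split=> //.
  by rewrite -[A]trmxK; apply: cone1_tr; exact: cone1_aut_infty ht.
by rewrite -[B]trmxK; apply: cone1_tr; exact: cone1_aut_infty ht'.
Qed.

End Isomorphisms.

Theorem theorem11 (R : realType) (p q : \bar R) (n : nat) (A : 'M[R]_(1 + n))
  (hp : (1%:E <= p)%E) (hq : (1%:E <= q)%E) (hpq : (p <= q)%E)
  (hn : (2 <= n)%N) (hpqn : (p, q, n) <> (1%:E, +oo%E, 2%N))
  (hA : A \in unitmx) (hiso : mximage A (pcone n p) = pcone n q) :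
  p = q /\ (p <> 2%:E -> cone_aut (pcone n 1%:E) A).
Proof.
have n0 : (0 < n)%N by apply: leq_trans hn.
have h := mximage_cone_iso _ _ _ hA hiso; have h' := cone_iso_sym _ _ _ _ h.
suff [pq H] : p = q /\ (p <> 2%:E -> cone_iso 1%:E 1%:E A (invmx A)).
  by split=> // /H /cone_iso_mximage.
have cases (r : \bar R) : (1%:E <= r)%E ->
    [\/ r = 1%:E, r = +oo%E | exists2 s, r = s%:E & 1 < s].
  case: r => [r| |]//; last by constructor 2.
  rewrite lee_fin le_eqVlt => /predU1P[->|r1]; first by constructor 1.
  by constructor 3; exists r.
have flat1 v := @flat_1 R n v hn.
have flaty v := @flat_infty R n v hn.
(* Flat directions refute the cases with exactly one exponent strictly between 1 and oo. *)
have [pE|pE|[r pE r1]] := cases p hp; have [qE|qE|[s qE s1]] := cases q hq;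
  rewrite pE qE in h h' hpq hpqn hp hq *.
- by [].
- exfalso; apply: (cone1_not_iso_infty _ _ _ h).
  by rewrite ltn_neqAle hn andbT; apply/eqP => n2; apply: hpqn; rewrite -n2.
- by case: (flat_cone_not_iso _ _ _ _ n0 hp s1 flat1 h).
- by rewrite leye_eq in hpq.
- by split=> // _; exact: cone_iso_infty_cone1.
- by case: (flat_cone_not_iso _ _ _ _ n0 hp s1 flaty h).
- by case: (flat_cone_not_iso _ _ _ _ n0 hq r1 flat1 h').
- by case: (flat_cone_not_iso _ _ _ _ n0 hq r1 flaty h').
(* If the exponents differ, [cone_iso_exponent] in both directions makes both equal to 2. *)
have rs : r = s.
  have [//|r2] := cone_iso_exponent r s _ _ hn r1 s1 h.
  by have [//|s2] := cone_iso_exponent s r _ _ hn s1 r1 h'; rewrite r2 s2.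
split; first by rewrite rs.
move=> r2; apply: (@cone_iso_cone1 R n r) => //; first by move=> e; apply: r2; rewrite e.
by move: h; rewrite -rs.
Qed.
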